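(* Let $K$ be a finite non-empty set of states, $A$ an arbitrary non-empty set of actions, $q:K\times A\to\Delta(K)$ a transition function, $g:K\times A\to[0,1]$ a reward function, and $p_0\in\Delta(K)$ an initial probability. Then the Markov decision process $\Psi(p_0)=(K,A,q,g,p_0)$ (with perfectly observed states) has a uniform value.
   Context: $\Delta(K)$ is the set of probability distributions on $K$. The MDP $\Psi(p_0)$ is played as follows. An initial state $k_1\in K$ is selected according to $p_0$ and told to the decision maker, who selects $a_1\in A$ and receives the payoff $g(k_1,a_1)$. A new state $k_2$ is selected according to $q(k_1,a_1)$ and told to the decision maker, who selects $a_2\in A$, and so on. A strategy is a sequence $\sigma=(\sigma_t)_{t\geq1}$ where $\sigma_t:(K\times A)^{t-1}\times K\to A$ gives the action at stage $t$ as a function of past states and actions and the current state. Let $\gamma_n^{p_0}(\sigma)=\mathbb{E}_{p_0,\sigma}\left[\frac1n\sum_{t=1}^n g(k_t,a_t)\right]$ be the expected average payoff over the first $n$ stages, and $v_n(p_0)=\sup_\sigma\gamma_n^{p_0}(\sigma)$ the $n$-stage value. $\Psi(p_0)$ has a uniform value if $\sup_\sigma\left(\liminf_n\gamma_n^{p_0}(\sigma)\right)=\limsup_n v_n(p_0)$; equivalently, $(v_n(p_0))_n$ converges to some $v(p_0)$ and for every $\varepsilon>0$ there is a strategy $\sigma$ with $\liminf_n\gamma_n^{p_0}(\sigma)\geq v(p_0)-\varepsilon$. *)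

(* Defs.v *)
From mathcomp Require Import all_boot all_order all_algebra.
From mathcomp Require Import all_classical all_reals all_analysis.

Set Implicit Arguments.
Unset Strict Implicit.
Unset Printing Implicit Defensive.

Import Order.TTheory GRing.Theory Num.Theory.
Local Open Scope classical_set_scope.
Local Open Scope ring_scope.

Definition is_distr (R : realType) (K : finType) (p : K -> R) : Prop :=
  (forall k, 0 <= p k) /\ \sum_(k : K) p k = 1.

(* [s h k] is the action at stage [size h + 1], where [h] lists the past
   (state, action) pairs in chronological order and [k] is the current state:
   a map on [seq (K * A)] is a sequence of maps on (K * A)^(t-1), t >= 1. *)
Definition strategy (K : finType) (A : Type) : Type := seq (K * A) -> K -> A.

(* The play obtained by extending the history [h] with the states [w], the
   actions being those prescribed by [s]. *)
Fixpoint play_from (K : finType) (A : Type) (s : strategy K A)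
    (h : seq (K * A)) (w : seq K) : seq (K * A) :=
  if w is k :: w' then play_from s (rcons h (k, s h k)) w' else h.

Definition play (K : finType) (A : Type) (s : strategy K A) (w : seq K) :
  seq (K * A) := play_from s [::] w.

(* p(k_1) q(k_1,a_1)(k_2) ... q(k_(n-1),a_(n-1))(k_n) *)
Fixpoint play_prob (R : realType) (K : finType) (A : Type)
    (q : K -> A -> K -> R) (p : K -> R) (h : seq (K * A)) : R :=
  if h is (k, a) :: h' then p k * play_prob q (q k a) h' else 1.

(* Strategies being deterministic, the first n stages are determined by
   (k_1, ..., k_n), so the expectation is a finite sum over K^n.  The value at
   n = 0 is 0 and plays no role in the asymptotic notions below. *)
Definition avg_payoff (R : realType) (K : finType) (A : Type)
    (q : K -> A -> K -> R) (g : K -> A -> R) (p0 : K -> R)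
    (s : strategy K A) (n : nat) : R :=
  \sum_(w : n.-tuple K)
    play_prob q p0 (play s w) *
    (n%:R^-1 * \sum_(x <- play s w) g x.1 x.2).

Definition value (R : realType) (K : finType) (A : Type)
    (q : K -> A -> K -> R) (g : K -> A -> R) (p0 : K -> R) (n : nat) : \bar R :=
  ereal_sup [set (avg_payoff q g p0 s n)%:E | s in [set: strategy K A]].

Definition has_uniform_value (R : realType) (K : finType) (A : Type)
    (q : K -> A -> K -> R) (g : K -> A -> R) (p0 : K -> R) : Prop :=
  ereal_sup [set limn_einf (fun n => (avg_payoff q g p0 s n)%:E)
            | s in [set: strategy K A]]
  = limn_esup (value q g p0).

(* Main.v *)
Require Import Defs.
From mathcomp Require Import all_boot all_order all_algebra.
From mathcomp Require Import all_classical all_reals all_analysis.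
From mathcomp Require Import lra zify.
Set Implicit Arguments.
Unset Strict Implicit.
Import Order.TTheory GRing.Theory Num.Theory.
Local Open Scope ring_scope.

(** The state process is random, but under a Markov plan (a rule choosing the
    action from the date and the current state) its law evolves
    deterministically in the simplex of distributions on [K], and the expected
    sum of payoffs is a function of this trajectory of laws.  So the problem is
    a deterministic one on a compact space.  History-dependent strategies bring
    no more than Markov plans over a finite horizon, by backward induction
    ([markov_dominates]).

    Say that [c] is guaranteed up to [n] at the law [p] if one plan has all its
    averages over the first 1, 2, ..., [n] stages at least [c], and that [c] is
    sustainable at [p] if this is so for every [n], with a plan that may depend
    on [n].  The value is the supremum [y] of the numbers sustainable at some
    law reachable from [p0].  Three facts give this.

    Compactness ([uniform_sustainable]): guaranteed values are 1-Lipschitz in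
    the law and decrease with the horizon, so, as in Dini's theorem, one
    horizon [n] works for the whole simplex: guaranteed up to [n] implies
    sustainable up to a small loss.

    Good windows ([exists_good_window]): if a long play has average above [c],
    then after some stage [m] all averages over windows of length at most [n]
    starting at [m] are at least [c]; otherwise the play could be cut into
    short blocks of average below [c].  With compactness, a long play of
    average above [y + e] would pass through a law where more than [y] is
    sustainable, so [y] bounds the limit of the values from above.

    Concatenation ([promising_plan]): at a law where more than [c] is
    sustainable, a long guaranteed play contains, after its first stage, a law
    where again more than [c] is sustainable, and the averages up to that stage
    are all at least [c].  Pasting such pieces yields a single infinite plan
    whose averages are all at least [c], and [c] can be taken as close to [y]
    as desired. *)

(** * Laws and expected payoffs under Markov plans *)

Section LawDynamics.

Variables (R : realType) (K : finType) (A : Type).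
Variables (q : K -> A -> K -> R) (g : K -> A -> R).

Definition plan := nat -> K -> A.

Definition push (p : K -> R) (f : K -> A) : K -> R :=
  fun j => \sum_k p k * q k (f k) j.

Fixpoint law (p : K -> R) (s : plan) (t : nat) : K -> R :=
  if t is t'.+1 then push (law p s t') (s t') else p.

Definition stage_payoff (p : K -> R) (f : K -> A) : R :=
  \sum_k p k * g k (f k).

Definition total (p : K -> R) (s : plan) (n : nat) : R :=
  \sum_(t < n) stage_payoff (law p s t) (s t).

Definition delay (m : nat) (s : plan) : plan := fun t => s (m + t)%N.

Definition splice (m : nat) (s s' : plan) : plan :=
  fun t => if (t < m)%N then s t else s' (t - m)%N.

Definition dist1 (p p' : K -> R) : R := \sum_k `|p k - p' k|.

Lemma total0 p s : total p s 0 = 0.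
Proof. by rewrite /total big_ord0. Qed.

Lemma totalS p s n :
  total p s n.+1 = total p s n + stage_payoff (law p s n) (s n).
Proof. by rewrite /total big_ord_recr. Qed.

Lemma law_add p s m t : law p s (m + t) = law (law p s m) (delay m s) t.
Proof. by elim: t => [|t IHt]; rewrite ?addn0// addnS /= IHt. Qed.

Lemma total_add p s m t :
  total p s (m + t) = total p s m + total (law p s m) (delay m s) t.
Proof.
elim: t => [|t IHt]; first by rewrite addn0 total0 addr0.
by rewrite addnS !totalS IHt -addrA law_add.
Qed.

Lemma eq_law p s s' n :
  (forall t, (t < n)%N -> s t = s' t) -> law p s n = law p s' n.
Proof.
elim: n => // n IHn ss' /=; rewrite ss'// IHn// => t tn.
exact/ss'/ltnW.
Qed.

Lemma eq_total p s s' n :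
  (forall t, (t < n)%N -> s t = s' t) -> total p s n = total p s' n.
Proof.
move=> ss'; apply: eq_bigr => -[t tn] _ /=.
rewrite ss'//; congr stage_payoff; apply: eq_law => u ut.
by apply: ss'; exact: ltn_trans tn.
Qed.

Lemma law_splice p s s' m t :
  law p (splice m s s') (m + t) = law (law p s m) s' t.
Proof.
rewrite law_add (_ : law p _ m = law p s m); last first.
  by apply: eq_law => u um; rewrite /splice um.
by apply: eq_law => u _; rewrite /delay /splice ltnNge leq_addr/= addKn.
Qed.

Lemma total_splice p s s' m t :
  total p (splice m s s') (m + t) = total p s m + total (law p s m) s' t.
Proof.
rewrite total_add; congr (_ + _).
  by apply: eq_total => u um; rewrite /splice um.
rewrite (_ : law p _ m = law p s m); last first.
  by apply: eq_law => u um; rewrite /splice um.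
by apply: eq_total => u _; rewrite /delay /splice ltnNge leq_addr/= addKn.
Qed.

(** The law depends linearly on the initial law; the mixture form is what the
    first stage produces, [push p f] being the mixture of the [q k (f k)]. *)
Lemma law_mix (c : K -> R) (P : K -> K -> R) s t :
  law (fun j => \sum_k c k * P k j) s t =
  fun j => \sum_k c k * law (P k) s t j.
Proof.
elim: t => //= t ->; apply: funext => j; rewrite /push /=.
under eq_bigr do rewrite mulr_suml.
rewrite exchange_big/=; apply: eq_bigr => k _.
by rewrite mulr_sumr; apply: eq_bigr => i _; rewrite mulrA.
Qed.

Lemma total_mix (c : K -> R) (P : K -> K -> R) s n :
  total (fun j => \sum_k c k * P k j) s n = \sum_k c k * total (P k) s n.
Proof.
rewrite /total; under [RHS]eq_bigr do rewrite mulr_sumr.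
rewrite [RHS]exchange_big/=; apply: eq_bigr => t _; rewrite law_mix /stage_payoff /=.
under eq_bigr do rewrite mulr_suml.
rewrite exchange_big/=; apply: eq_bigr => k _.
by rewrite mulr_sumr; apply: eq_bigr => i _; rewrite mulrA.
Qed.

Lemma total_recl p s n :
  total p s n.+1 =
  \sum_k p k * (g k (s 0%N k) + total (q k (s 0%N k)) (delay 1 s) n).
Proof.
rewrite -add1n total_add totalS total0 add0r /= /push total_mix -big_split/=.
by apply: eq_bigr => k _; rewrite mulrDr.
Qed.

Hypothesis hq : forall k a, is_distr (q k a).
Hypothesis hg : forall k a, 0 <= g k a <= 1.

Lemma push_distr p f : is_distr p -> is_distr (push p f).
Proof.
move=> [p0 p1]; split=> [j|].
  by apply: sumr_ge0 => k _; apply: mulr_ge0 => //; exact: (hq k (f k)).1.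
rewrite /push exchange_big/= -p1; apply: eq_bigr => k _.
by rewrite -mulr_sumr (hq k (f k)).2 mulr1.
Qed.

Lemma law_distr p s t : is_distr p -> is_distr (law p s t).
Proof. by move=> pP; elim: t => //= t; exact: push_distr. Qed.

Lemma stage_payoff_bound p f : is_distr p -> 0 <= stage_payoff p f <= 1.
Proof.
move=> [p0 <-]; apply/andP; split.
  by apply: sumr_ge0 => k _; apply: mulr_ge0 => //; case/andP: (hg k (f k)).
by apply: ler_sum => k _; rewrite ler_piMr//; case/andP: (hg k (f k)).
Qed.

Lemma total_incr p s m t : is_distr p ->
  0 <= total p s (m + t) - total p s m <= t%:R.
Proof.
move=> pP; elim: t => [|t]; first by rewrite addn0 subrr lexx.
rewrite addnS totalS -(natr1 t).
have := stage_payoff_bound (s (m + t)%N) (law_distr s (m + t) pP).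
by lra.
Qed.

Lemma total_bound p s n : is_distr p -> 0 <= total p s n <= n%:R.
Proof. by move=> /(total_incr s 0 n); rewrite add0n total0 subr0. Qed.

(** * Lipschitz dependence on the initial law *)

Lemma dist1_push p p' f : dist1 (push p f) (push p' f) <= dist1 p p'.
Proof.
rewrite /dist1 /push.
apply: (@le_trans _ _ (\sum_j \sum_k `|p k - p' k| * q k (f k) j)).
  apply: ler_sum => j _; rewrite -sumrB; apply: le_trans (ler_norm_sum _ _ _) _.
  apply: ler_sum => k _; rewrite -mulrBl normrM ler_wpM2l//.
  by rewrite ger0_norm//; exact: (hq k (f k)).1.
rewrite exchange_big/=; apply: ler_sum => k _.
by rewrite -mulr_sumr (hq k (f k)).2 mulr1.
Qed.

Lemma dist1_law p p' s t : dist1 (law p s t) (law p' s t) <= dist1 p p'.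
Proof. by elim: t => //= t; apply: le_trans; exact: dist1_push. Qed.

(** Transitions do not expand the l1 distance, so that at each stage the
    expected payoffs, which lie in [0, 1], differ by at most the initial
    distance. *)
Lemma total_lipschitz p p' s n :
  total p s n <= total p' s n + n%:R * dist1 p p'.
Proof.
elim: n => [|n IHn]; first by rewrite !total0 mul0r addr0.
rewrite !totalS -natr1 mulrDl mul1r addrACA lerD//.
apply: (@le_trans _ _ (stage_payoff (law p' s n) (s n) +
                       dist1 (law p s n) (law p' s n))); last first.
  by rewrite lerD2l dist1_law.
rewrite /stage_payoff /dist1 -big_split/=; apply: ler_sum => k _.
case/andP: (hg k (s n k)) => g0 g1.
rewrite -lerBlDl -mulrBl; apply: le_trans (ler_norm _) _.
by rewrite normrM ler_piMr// ger0_norm.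
Qed.

(** * Guaranteed and sustainable averages *)

Definition guarantee (n : nat) (c : R) (p : K -> R) : Prop :=
  exists s : plan, forall t, (t <= n)%N -> t%:R * c <= total p s t.

(** The guaranteeing plan may change with the horizon: a plan good for all
    horizons at once is not available at this stage, since [A] carries no
    topology from which to extract a limit plan. *)
Definition sustainable (c : R) (p : K -> R) : Prop :=
  forall n, guarantee n c p.

Lemma guarantee_le n c c' p : c' <= c -> guarantee n c p -> guarantee n c' p.
Proof.
move=> cc' [s sP]; exists s => t /sP; apply: le_trans.
by rewrite ler_wpM2l.
Qed.

Lemma guarantee_near n c p p' :
  guarantee n c p -> guarantee n (c - dist1 p p') p'.
Proof.
move=> [s sP]; exists s => t /sP ct.
by rewrite mulrBr lerBlDr (le_trans ct)// total_lipschitz.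
Qed.

Lemma guarantee_le1 n c p : is_distr p -> guarantee n.+1 c p -> c <= 1.
Proof.
move=> pP [s /(_ 1%N isT)]; rewrite mul1r => /le_trans; apply.
by case/andP: (total_bound s 1 pP).
Qed.

Lemma sustainable0 c p : inhabited A -> is_distr p -> c <= 0 -> sustainable c p.
Proof.
move=> [a] pP c0 n; exists (fun _ _ => a) => t _.
apply: (@le_trans _ _ 0); first exact: mulr_ge0_le0.
by case/andP: (total_bound (fun _ _ => a) t pP).
Qed.

(** Rounding each weight down to a multiple of [1 / N.+1] cuts the simplex into
    finitely many cells of small diameter, which is all the compactness that
    the proof uses. *)
Lemma finite_net (d : R) : 0 < d ->
  exists (C : finType) (code : (K -> R) -> C), forall p p',
    is_distr p -> is_distr p' -> code p = code p' -> dist1 p p' <= d.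
Proof.
move=> d0; pose N := Num.truncn (#|K|%:R / d).
have dN : #|K|%:R <= d * N.+1%:R.
  by rewrite mulrC -ler_pdivrMr// ltW// truncnS_gt.
have N0 : 0 < N.+1%:R :> R by [].
exists {ffun K -> 'I_N.+2}, (fun p => [ffun k => inord (Num.truncn (p k * N.+1%:R))]).
have trP (p : K -> R) (k : K) : is_distr p ->
    (Num.truncn (p k * N.+1%:R))%:R <= p k * N.+1%:R /\
    p k * N.+1%:R < (Num.truncn (p k * N.+1%:R)).+1%:R /\
    (Num.truncn (p k * N.+1%:R) < N.+2)%N.
  move=> [p0 p1]; have pk0 : 0 <= p k * N.+1%:R by rewrite mulr_ge0.
  case/andP: (truncn_itv pk0) => lo hi; split=> //; split=> //.
  rewrite -(@ltr_nat R) (le_lt_trans lo)// (@le_lt_trans _ _ N.+1%:R)//.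
    rewrite ler_piMl// -p1 (bigD1 k)//= lerDl; exact: sumr_ge0.
  by rewrite ltr_nat.
move=> p p' pP p'P /ffunP eqc; rewrite /dist1.
apply: (@le_trans _ _ (\sum_(k : K) N.+1%:R^-1)); last first.
  rewrite sumr_const -[_ *+ _]mulr_natl ler_pdivrMr//.
apply: ler_sum => k _.
have := congr1 val (eqc k); rewrite !ffunE/=.
have [lo [hi b]] := trP _ k pP; have [lo' [hi' b']] := trP _ k p'P.
rewrite !inordK// => e; rewrite -e in lo' hi'.
rewrite -(ler_pM2r N0) mulVf ?gt_eqF// -{1}(ger0_norm (ltW N0)) -normrM.
rewrite mulrBl ler_norml; move: lo hi lo' hi'; rewrite -!natr1.
by lra.
Qed.

(** Dini's argument: at one point of each cell, a horizon beyond which the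
    guaranteed value is within [e / 4] of its limit serves the whole cell.  The
    passages to that point and back cost [e / 4] each, and so does replacing
    the limit value, a supremum, by a sustainable one.  Then take the largest
    horizon over the finitely many cells. *)
Lemma uniform_sustainable (e : R) : inhabited A -> 0 < e ->
  exists n, forall p c, is_distr p -> guarantee n c p -> sustainable (c - e) p.
Proof.
move=> hA e0; have d0 : 0 < e / 4 by lra.
have [C [code codeP]] := finite_net d0.
have cell (x : C) : exists n, forall p c, is_distr p -> code p = x ->
    guarantee n c p -> sustainable (c - e) p.
  have [[p0 [p0P <-]]|nx] :=
    pselect (exists p0, is_distr p0 /\ code p0 = x); last first.
    by exists 0%N => p c pP px; exfalso; apply: nx; exists p.
  pose X := [set c | sustainable c p0]%classic.
  have X0 : X 0 by exact: sustainable0.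
  have hX : has_sup X.
    split; first by exists 0.
    by exists 1 => c /(_ 1%N); exact: guarantee_le1.
  have : ~ sustainable (sup X + e / 4) p0.
    by move=> /(ub_le_sup hX.2); lra.
  move=> /existsNP[n nP]; exists n => p c pP px cn m.
  have pp0 := codeP _ _ pP p0P px.
  have p0p := codeP _ _ p0P pP (esym px).
  have cX : c - e / 4 < sup X + e / 4.
    rewrite ltNge; apply/negP => le; apply: nP.
    apply: guarantee_le le _; apply: guarantee_le (guarantee_near p0 cn).
    by lra.
  have [c' c'X lt] := sup_adherent d0 hX.
  by apply: guarantee_le (guarantee_near p (c'X m)); lra.
have [N NP] := choice cell.
exists (\max_x N x)%N => p c pP [s sP]; apply: (NP (code p)) => //.
by exists s => t tN; apply: sP; rewrite (leq_trans tN)// leq_bigmax.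
Qed.

(** * Stages from which all short averages are good *)

(** If every stage [m] had a window of length at most [n] with average below
    [c], consecutive bad windows would cover the play up to a remainder shorter
    than [n], which earns at most [n]. *)
Lemma exists_good_window (F : nat -> R) (N n m0 : nat) (c : R) :
  (forall m t, 0 <= F (m + t)%N - F m <= t%:R) ->
  (m0 <= N)%N -> n%:R + (N - m0)%:R * c < F N - F m0 ->
  exists m, [/\ (m0 <= m)%N, (m <= N)%N &
    forall t, (t <= n)%N -> t%:R * c <= F (m + t)%N - F m].
Proof.
move=> F1 m0N big; apply: contrapT => none.
(* For negative [c] any stage will do; below, [0 <= c] is what lets the last,
   truncated window be bounded by [n] alone. *)
have [c0|c0] := ltP c 0.
  apply: none; exists m0; split=> // t _; apply: (@le_trans _ _ 0).
    by rewrite mulr_ge0_le0// ltW.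
  by case/andP: (F1 m0 t).
suff H : forall d m, (N - m <= d)%N -> (m0 <= m <= N)%N ->
    F N - F m <= n%:R + (N - m)%:R * c.
  by move: big; rewrite ltNge (H _ _ (leqnn _))// leqnn.
elim=> [|d IHd] m dm /andP[m0m mN].
  have -> : m = N by lia.
  by rewrite subnn mul0r addr0 subrr.
have /existsNP[t /not_implyP[tn /negP]] : ~ forall t, (t <= n)%N ->
    t%:R * c <= F (m + t)%N - F m.
  by move=> mP; apply: none; exists m.
rewrite -ltNge => lt.
have t0 : (0 < t)%N.
  by rewrite lt0n; apply/eqP => t0; move: lt; rewrite t0 addn0 mul0r subrr ltxx.
have [mtN|Nmt] := leqP (m + t)%N N.
  have := IHd (m + t)%N ltac:(lia) ltac:(lia).
  have -> : (N - m = (N - (m + t)) + t)%N by lia.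
  by rewrite natrD mulrDl; lra.
have := F1 m (N - m)%N; rewrite subnKC// => /andP[_ le].
apply: (le_trans le); apply: (@le_trans _ _ n%:R).
  by rewrite ler_nat; lia.
by rewrite lerDl mulr_ge0.
Qed.

Lemma exists_good_stage p s (N n m0 : nat) (c : R) : is_distr p ->
  (m0 <= N)%N -> n%:R + (N - m0)%:R * c < total p s N - total p s m0 ->
  exists m, [/\ (m0 <= m)%N, (m <= N)%N & guarantee n c (law p s m)].
Proof.
move=> pP m0N big.
have [m [m0m mN mP]] :=
  exists_good_window (fun m t => total_incr s m t pP) m0N big.
exists m; split=> //; exists (delay m s) => t /mP.
by rewrite total_add; lra.
Qed.

(** * Concatenation into an infinite plan *)

(** The strict margin above [c] may shrink from one concatenated piece to the
    next, which spares the bookkeeping of summable errors. *)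
Definition promising (c : R) (p : K -> R) : Prop :=
  exists2 x, c < x & sustainable x p.

Lemma natr_gt_mul (d x : R) : 0 < d -> exists n, x < n%:R * d.
Proof.
move=> d0; exists (Num.truncn (x / d)).+1.
by rewrite -ltr_pdivrMr// truncnS_gt.
Qed.

(** Looking for the good stage only from stage 1 on makes the piece nonempty and
    costs one unit of total payoff, negligible over a long play.  A third of
    the margin is spent on finding that stage, and another third on going from
    a guarantee up to [n] to sustainability. *)
Lemma promising_continuation c p : inhabited A -> is_distr p -> promising c p ->
  exists s m, [/\ (0 < m)%N, forall t, (t <= m)%N -> t%:R * c <= total p s t
    & promising c (law p s m)].
Proof.
move=> hA pP [x cx xP].
pose d := (x - c) / 3; have d0 : 0 < d by rewrite /d; lra.
have [n nP] := uniform_sustainable hA d0.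
have [N NP] := natr_gt_mul (n%:R + 1 - x) d0.
have [s sP] := xP N.+1.
have [|m [m0 mN mP]] := @exists_good_stage p s N.+1 n 1 (x - d) pP isT.
  rewrite subSS subn0 mulrBr; have := sP N.+1 (leqnn _).
  case/andP: (total_bound s 1 pP) => _; rewrite -(natr1 N) mulrDl mul1r.
  by move: NP; rewrite mulr1n; lra.
exists s, m; split=> //.
  move=> t tm; apply: le_trans (sP t (leq_trans tm mN)).
  by rewrite ler_wpM2l// ltW.
exists (x - d - d); first by rewrite /d; lra.
exact: nP (law_distr _ _ pP) mP.
Qed.

(** A pair [(s, m)] stands for the part of the plan [s] before stage [m].  The
    pairs built by successive extension agree on their common part, so the
    diagonal [t |-> s_(t+1) t] coincides with each of them on its part. *)
Lemma promising_plan c p : inhabited A -> is_distr p -> promising c p ->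
  exists s, forall t, t%:R * c <= total p s t.
Proof.
move=> hA pP pc.
pose ok (b : plan * nat) := promising c (law p b.1 b.2) /\
  forall t, (t <= b.2)%N -> t%:R * c <= total p b.1 t.
have step (b : plan * nat) : exists b' : plan * nat, ok b ->
    [/\ ok b', (b.2 < b'.2)%N & forall t, (t < b.2)%N -> b'.1 t = b.1 t].
  have [[bc bt]|nb] := pselect (ok b); last by exists b.
  have [s [m [m0 sP mc]]] := promising_continuation hA (law_distr b.1 b.2 pP) bc.
  exists (splice b.2 b.1 s, (b.2 + m)%N) => _; split=> /=.
  - split=> /=; first by rewrite law_splice.
    move=> t tm; have [tb|bt'] := leqP t b.2.
      rewrite (@eq_total _ _ b.1); first exact: bt.
      by move=> u ut; rewrite /splice (leq_trans ut).
    rewrite -(subnKC (ltnW bt')) total_splice natrD mulrDl lerD//; first exact: bt.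
    by apply: sP; lia.
  - by rewrite -[X in (X < _)%N]addn0 ltn_add2l.
  - by move=> t tb; rewrite /splice tb.
have [f fP] := choice step.
have [a] := hA.
pose B i := iter i f (fun=> fun=> a, 0%N).
have okB i : ok (B i).
  elim: i => [|i IHi]; last by have [] := fP _ IHi.
  by split=> // t; rewrite leqn0 => /eqP ->; rewrite mul0r total0.
have Bge i : (i <= (B i).2)%N.
  elim: i => // i IHi; have [_ lt _] := fP _ (okB i).
  exact: leq_ltn_trans lt.
have Bstable i j t : (t < (B i).2)%N -> (B (i + j)%N).1 t = (B i).1 t.
  move=> ti; suff [-> //] : (B (i + j)%N).1 t = (B i).1 t /\ (t < (B (i + j)%N).2)%N.
  elim: j => [|j [IHe IHl]]; first by rewrite addn0.
  rewrite addnS; have [_ lt eq] := fP _ (okB (i + j)%N).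
  by split; [rewrite /= eq | exact: ltn_trans lt].
exists (fun t => (B t.+1).1 t) => t.
rewrite (@eq_total _ _ (B t).1); first exact: (okB t).2.
move=> u ut; rewrite -(subnKC ut) Bstable//; exact: Bge.
Qed.

(** Here [y] is the supremum of what is sustainable at reachable laws.  The
    prefix leading to a nearly optimal such law lasts [m0] stages and is
    forgotten in the long-run average. *)
Lemma markov_uniform p (e : R) : inhabited A -> is_distr p -> 0 < e ->
  exists y (s : plan) N, forall n, (N <= n)%N ->
    n%:R * (y - e) <= total p s n /\
    forall s', total p s' n <= n%:R * (y + e).
Proof.
move=> hA pP e0.
pose X := [set c | exists s m, sustainable c (law p s m)]%classic.
have [a] := hA.
have hX : has_sup X.
  split; first by exists 0, (fun=> fun=> a), 0%N; exact: sustainable0.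
  exists 1 => c [s [m /(_ 1%N)]]; apply: guarantee_le1; exact: law_distr.
have d0 : 0 < e / 3 by lra.
have [c [s0 [m0 cP]] ltc] := sup_adherent d0 hX.
have [|s1 s1P] := @promising_plan (c - e / 3) _ hA (law_distr s0 m0 pP).
  by exists c => //; lra.
have [n0 n0P] := uniform_sustainable hA d0.
have [N1 N1P] := natr_gt_mul n0%:R d0.
have [N2 N2P] := natr_gt_mul (m0%:R * (sup X - 2 * (e / 3))) d0.
exists (sup X), (splice m0 s0 s1), (m0 + N1 + N2)%N => n nN; split.
  have -> : (n = m0 + (n - m0))%N by lia.
  rewrite total_splice.
  case/andP: (total_bound s0 m0 pP) => tot0 _.
  have := s1P (n - m0)%N.
  have : N2%:R * (e / 3) <= (n - m0)%:R * (e / 3).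
    by rewrite ler_pM2r// ler_nat; lia.
  have : m0%:R * e >= 0 by rewrite mulr_ge0// ltW.
  have : (n - m0)%:R * (sup X - e / 3) <= (n - m0)%:R * c.
    by rewrite ler_wpM2l// ltW.
  by rewrite natrD; lra.
move=> s'; rewrite leNgt; apply/negP => big.
have [|m [_ _ mP]] := @exists_good_stage p s' n n0 0 (sup X + e / 3 + e / 3) pP isT.
  rewrite subn0 total0 subr0; apply: le_lt_trans big.
  have : N1%:R * (e / 3) <= n%:R * (e / 3).
    by rewrite ler_pM2r// ler_nat; lia.
  by lra.
have sX : X (sup X + e / 3).
  exists s', m; have := n0P _ _ (law_distr s' m pP) mP.
  by rewrite addrK.
by have := ub_le_sup hX.2 sX; lra.
Qed.



(** * From history-dependent strategies to Markov plans *)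

Definition expected_sum (p : K -> R) (s : strategy K A) (n : nat) : R :=
  \sum_(w : n.-tuple K)
    play_prob q p (play s w) * \sum_(x <- play s w) g x.1 x.2.

Definition after (x : K * A) (s : strategy K A) : strategy K A :=
  fun h => s (x :: h).

Definition markov (s : plan) : strategy K A := fun h => s (size h).

Lemma avg_payoffE p s n :
  avg_payoff q g p s n = n%:R^-1 * expected_sum p s n.
Proof.
by rewrite mulr_sumr; apply: eq_bigr => w _; rewrite mulrCA.
Qed.

Lemma play_cons s k w :
  play s (k :: w) = (k, s [::] k) :: play (after (k, s [::] k) s) w.
Proof.
rewrite /play /=; set x := (k, _).
by elim: w [::] => //= k' w IHw h; rewrite -IHw.
Qed.

Lemma big_tuple_nil (T : finType) (F : seq T -> R) :
  \sum_(w : 0.-tuple T) F w = F [::].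
Proof. by rewrite (big_pred1 [tuple]) // => w; apply/esym/eqP/tuple0. Qed.

Lemma big_tuple_cons (T : finType) n (F : seq T -> R) :
  \sum_(w : n.+1.-tuple T) F w = \sum_x \sum_(w : n.-tuple T) F (x :: w).
Proof.
rewrite pair_big/= (reindex (fun xw : T * n.-tuple T => [tuple of xw.1 :: xw.2])).
  by apply: eq_bigr => -[x w].
exists (fun w => (thead w, [tuple of behead w])) => [[x w] _|w _] /=.
  by congr pair; apply: val_inj.
by rewrite [RHS]tuple_eta.
Qed.

Lemma sum_play_prob p s n : is_distr p ->
  \sum_(w : n.-tuple K) play_prob q p (play s w) = 1.
Proof.
elim: n p s => [|n IHn] p s pP.
  by rewrite (big_tuple_nil (fun w => play_prob q p (play s w))).
rewrite (big_tuple_cons n (fun w => play_prob q p (play s w))) -pP.2.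
apply: eq_bigr => k _; under eq_bigr do rewrite play_cons /=.
by rewrite -mulr_sumr IHn ?mulr1.
Qed.

Lemma expected_sum0 p s : expected_sum p s 0 = 0.
Proof.
rewrite /expected_sum
  (big_tuple_nil (fun w => play_prob q p (play s w) * \sum_(x <- play s w) g x.1 x.2)).
by rewrite big_nil mulr0.
Qed.

Lemma expected_sumS p s n :
  expected_sum p s n.+1 = \sum_k p k * (g k (s [::] k) +
    expected_sum (q k (s [::] k)) (after (k, s [::] k) s) n).
Proof.
rewrite /expected_sum (big_tuple_cons n (fun w => play_prob q p (play s w) * \sum_(x <- play s w) g x.1 x.2)).
apply: eq_bigr => k _.
rewrite -[g k _]mul1r -(sum_play_prob (after (k, s [::] k) s) n (hq k (s [::] k))).
rewrite mulr_suml -big_split mulr_sumr; apply: eq_bigr => w _.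
by rewrite play_cons /= big_cons /= -mulrDr mulrA.
Qed.

Lemma expected_sum_markov p s n : expected_sum p (markov s) n = total p s n.
Proof.
elim: n p s => [|n IHn] p s.
  by rewrite expected_sum0 total0.
rewrite expected_sumS total_recl; apply: eq_bigr => k _.
by rewrite -IHn.
Qed.

(** Backward induction: an action nearly maximizing the current payoff plus the
    optimal continuation is chosen in each state.  The errors are halved at
    each step as suprema over [A] need not be attained; the plan works for all
    initial laws and all strategies at once. *)
Lemma markov_dominates n (e : R) : inhabited A -> 0 < e ->
  exists s, forall p s', is_distr p ->
    expected_sum p s' n <= total p s n + e.
Proof.
move=> hA; elim: n e => [|n IHn] e e0.
  have [a] := hA; exists (fun=> fun=> a) => p s' _.
  by rewrite expected_sum0 total0 add0r ltW.
have d0 : 0 < e / 2 by lra.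
have [s sP] := IHn _ d0.
pose payoff k a := g k a + total (q k a) s n.
have greedy k : exists a, forall b, payoff k b <= payoff k a + e / 2.
  pose X := range (payoff k).
  have hX : has_sup X.
    split; first by have [a] := hA; exists (payoff k a), a.
    exists (1 + n%:R) => _ [a _ <-]; rewrite lerD//; first by case/andP: (hg k a).
    by case/andP: (total_bound s n (hq k a)).
  have [_ [a _ <-] lt] := sup_adherent d0 hX.
  exists a => b; have := ub_le_sup hX.2 (imageT (payoff k) b); rewrite -/X; lra.
have [f fP] := choice greedy.
exists (splice 1 (fun=> f) s) => p s' pP.
rewrite expected_sumS total_recl -[e]mul1r -pP.2 mulr_suml -big_split/=.
apply: ler_sum => k _; rewrite -mulrDr ler_wpM2l//; first exact: pP.1.
have := sP _ (after (k, s' [::] k) s') (hq k (s' [::] k)).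
have := fP k (s' [::] k); rewrite /payoff.
have -> : splice 1 (fun=> f) s 0%N = f by [].
have -> : delay 1 (splice 1 (fun=> f) s) = s.
  by apply: funext => t; rewrite /delay /splice add1n /= subSS subn0.
by lra.
Qed.

(** Since [y] bounds the payoffs of all strategies from above and those of [s]
    from below, up to [e] and from some horizon on, the limit superior of the
    values and the limit inferior of the payoffs of [s] differ by at most
    [2 * e]. *)
Lemma uniform_strategy p (e : R) : inhabited A -> is_distr p -> 0 < e ->
  exists y (s : strategy K A) N, forall n, (N <= n)%N ->
    y - e <= avg_payoff q g p s n /\
    forall s', avg_payoff q g p s' n <= y + e.
Proof.
move=> hA pP e0; have d0 : 0 < e / 2 by lra.
have [y [s [N NP]]] := markov_uniform hA pP d0.
(* The empty average is 0, hence the restriction to positive horizons. *)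
exists y, (markov s), (maxn 1 N) => n; rewrite geq_max => /andP[n0 Nn].
have [lo hi] := NP n Nn; have nR : 0 < n%:R :> R by rewrite ltr0n.
split=> [|s']; rewrite avg_payoffE mulrC.
  rewrite expected_sum_markov ler_pdivlMr// mulrC.
  by apply: le_trans lo; rewrite ler_pM2l//; lra.
rewrite ler_pdivrMr// mulrC.
have nd0 : 0 < n%:R * (e / 2) by rewrite mulr_gt0.
have [s'' s''P] := markov_dominates n hA nd0.
by have := s''P p s' pP; have := hi s''; lra.
Qed.

End LawDynamics.

(** * Lower and upper limits in the extended reals *)

Lemma limn_esup_le (R : realType) (u : nat -> \bar R) (y : \bar R) N :
  (forall n, (N <= n)%N -> (u n <= y)%E) -> (limn_esup u <= y)%E.
Proof.
move=> uy; rewrite /limn_esup /limf_esup.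
apply: (@le_trans _ _ (ereal_sup [set u n | n in [set n | (N <= n)%N]]%classic)).
  by apply: ereal_inf_lbound; eexists; [exact: nbhs_infty_ge|].
by apply: ge_ereal_sup => _ [n Nn <-]; exact: uy.
Qed.

Lemma le_limn_einf (R : realType) (u : nat -> \bar R) (y : \bar R) N :
  (forall n, (N <= n)%N -> (y <= u n)%E) -> (y <= limn_einf u)%E.
Proof.
move=> yu; rewrite /limn_einf leeNr.
by apply: (@limn_esup_le _ _ _ N) => n /yu; rewrite leeN2.
Qed.

Lemma le_limn_esup (R : realType) (u v : nat -> \bar R) :
  (forall n, (u n <= v n)%E) -> (limn_esup u <= limn_esup v)%E.
Proof.
move=> uv; apply: le_ereal_inf_tmp => _ [V VF <-].
apply: (@le_trans _ _ (ereal_sup [set u n | n in V]%classic)).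
  by apply: ereal_inf_lbound; exists V.
apply: ge_ereal_sup => _ [n Vn <-]; apply: le_trans (uv n) _.
by apply: ereal_sup_ubound; exists n.
Qed.

Theorem theorem6p1 (R : realType) (K : finType) (A : Type)
    (q : K -> A -> K -> R) (g : K -> A -> R) (p0 : K -> R)
    (hK : (0 < #|K|)%N) (hA : inhabited A)
    (hq : forall (k : K) (a : A), is_distr (q k a))
    (hg : forall (k : K) (a : A), 0 <= g k a <= 1)
    (hp0 : is_distr p0) :
  has_uniform_value q g p0.
Proof.
apply/eqP; rewrite eq_le; apply/andP; split.
  apply: ge_ereal_sup => _ [s _ <-]; apply: le_trans (limn_einf_sup _) _.
  by apply: le_limn_esup => n; apply: ereal_sup_ubound; exists s.
apply/lee_addgt0Pr => e e0; have d0 : 0 < e / 2 by lra.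
have [y [s [N NP]]] := uniform_strategy hq hg hA hp0 d0.
apply: (@le_trans _ _ (y + e / 2)%:E).
  apply: (@limn_esup_le _ _ _ N) => n Nn.
  by apply: ge_ereal_sup => _ [s' _ <-]; rewrite lee_fin (NP n Nn).2.
rewrite -leeBlDr// -EFinB.
apply: (@le_trans _ _ (limn_einf (fun n => (avg_payoff q g p0 s n)%:E))).
  apply: (@le_limn_einf _ _ _ N) => n Nn; rewrite lee_fin.
  by apply: le_trans (NP n Nn).1; lra.
by apply: ereal_sup_ubound; exists s.
Qed.
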